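(* For $k\ge1$ the vector field $\Psi_k$ on $\mathrm{SL}(2,\mathbf C)$ defined by $g\mapsto g^k-g^{-k}$ acts on invariants in $\mathbf C[\mathrm{SL}(2,\mathbf C)]^{\mathrm{Ad}\,\mathrm{SL}(2,\mathbf C)}$ as follows, for all integers $m\ge0$: $$\Psi_k(I_m)=m(I_{m+k}-I_{m-k}),$$ $$\Psi_1(\chi_m)=m\,\chi_{m+1}-(m+2)\,\chi_{m-1},\qquad \Psi_1(J_m)=m\,(J_{m+1}-4J_{m-1}).$$
   Context: The vector field defined by a regular conjugation-equivariant map $\Phi:\mathrm{SL}(2,\mathbf C)\to\mathfrak{sl}(2,\mathbf C)$ acts by $f\mapsto\big(g\mapsto\frac{d}{dt}f(g+tg\Phi(g))|_{t=0}\big)$ on regular functions $f$ (extended to a neighborhood of $\mathrm{SL}(2,\mathbf C)$ in the $2\times2$ matrices). The invariant functions are $I_m(g)=\operatorname{tr}(g^m)$ (for all $m\in\mathbf Z$), $\chi_m(g)=$ the trace of $g$ on $S^mV$ with $V=\mathbf C^2$ (and $\chi_{-1}=0$), and $J_m(g)=\operatorname{tr}(g)^m$. For $m=0$ the right side of the last formula is read as $0$. *)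

(* Defs.v *)
From HB Require Import structures.
From mathcomp Require Import all_boot all_order all_algebra.
From mathcomp Require Import all_classical all_reals all_analysis.
From mathcomp Require Import complex ring.
(* The notations of mpoly clash with those of mathcomp-analysis. *)
From mathcomp Require Import -(notations) mpoly.

Set Implicit Arguments.
Unset Strict Implicit.
Unset Printing Implicit Defensive.

Import Order.TTheory GRing.Theory Num.Theory numFieldNormedType.Exports.
Local Open Scope classical_set_scope.
Local Open Scope ring_scope.

(* The field C = R[i]; naming it as a numFieldType lets its topology, and the
   normed-module structure of 'M[C]_2, be inferred. *)
Definition Cx (R : realType) : numFieldType := R[i]%C.

Section SL2.
Variable R : realType.
Local Notation C := (Cx R).

Record SL2 := MkSL2 { SL2val :> 'M[C]_2; SL2P : \det SL2val == 1 }.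

Lemma det_SL2 (g : SL2) : \det g = 1. Proof. exact/eqP/SL2P. Qed.

Lemma SL2_unit (g : SL2) : SL2val g \is a GRing.unit.
Proof. by rewrite -[_ \is a _]/(SL2val g \in unitmx) unitmxE det_SL2 unitr1. Qed.

Lemma conj_SL2_subproof (h g : SL2) : \det (SL2val h * g * (SL2val h)^-1) == 1.
Proof.
rewrite !det_mulmx -[(SL2val h)^-1]/(invmx h) det_inv !det_SL2.
by rewrite mulr1 mul1r invr1.
Qed.

Definition conj_SL2 (h g : SL2) : SL2 := MkSL2 (conj_SL2_subproof h g).

(* Evaluation of a polynomial in the four matrix entries; recall that 2 * 2
   computes to 4. *)
Definition mxeval (P : mpoly 4 C) (x : 'M[C]_2) : C :=
  meval (fun i => mxvec x 0 i) P.

Definition regular_fun (f : SL2 -> C) := exists P, forall g : SL2, f g = mxeval P g.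

(* C[SL(2,C)] *)
Record regfun := RegFun { regfun_val :> SL2 -> C; regfunP : regular_fun regfun_val }.

(* C[SL(2,C)]^{Ad SL(2,C)} *)
Record adinvfun := AdInvFun {
  adinvfun_val :> regfun;
  adinvfunP : forall h g, adinvfun_val (conj_SL2 h g) = adinvfun_val g }.

(* Regular conjugation-equivariant maps SL(2,C) -> sl(2,C), that is, the
   vector fields g |-> g * Phi g on SL(2,C). *)
Record vfield := VField {
  vfield_val :> SL2 -> 'M[C]_2;
  vfield_tr : forall g, \tr (vfield_val g) = 0;
  vfield_reg : forall i j, regular_fun (fun g => vfield_val g i j);
  vfield_conj : forall h g,
    vfield_val (conj_SL2 h g) = SL2val h * vfield_val g * (SL2val h)^-1 }.

(* A polynomial extension of f to the 2 x 2 matrices; vf_actP below shows that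
   vf_act depends neither on this choice nor on its being polynomial. *)
Definition ext (f : regfun) : 'M[C]_2 -> C := mxeval (projT1 (cid (regfunP f))).

Definition vf_act (Phi : vfield) (f : regfun) (g : SL2) : C :=
  derive1 (fun t : C => ext f (SL2val g + t *: (SL2val g * Phi g))) 0.

Lemma extE (f : regfun) (g : SL2) : ext f g = f g.
Proof. by rewrite /ext; case: cid => P /= ->. Qed.

Lemma differentiable_mxeval P x : differentiable (mxeval P : 'M[C]_2 -> C) x.
Proof.
rewrite /mxeval; elim/mpolyind: P => [|c m P _ _ IH].
  under eq_fun do rewrite meval0; exact: differentiable_cst.
under eq_fun do rewrite mevalD mevalZ mevalX.
apply: differentiableD => //; apply: differentiableM.
  exact: differentiable_cst.
elim: (index_enum _) => [|i s IHs].
  under eq_fun do rewrite big_nil; exact: differentiable_cst.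
under eq_fun do rewrite big_cons.
apply: differentiableM IHs.
case: (m i) => [|k]; first by under eq_fun do rewrite expr0; exact: differentiable_cst.
pose F (y : 'M[C]_2) : C := mxvec y 0 i.
have -> : (fun y : 'M[C]_2 => mxvec y 0 i ^+ k.+1) = F ^+ k.+1.
  by apply/funext => y; rewrite fctE.
apply: differentiableX; rewrite {}/F.
case/mxvec_indexP: i => i j.
by under eq_fun do rewrite mxvecE; exact: differentiable_coord.
Qed.

Lemma is_derive_path (F : 'M[C]_2 -> C) (c : C -> 'M[C]_2) (v : 'M[C]_2) :
  is_derive (0 : C) (1 : C) c v -> differentiable F (c 0) ->
  is_derive (0 : C) (1 : C) (F \o c) ('d F (c 0) v).
Proof.
move=> [dc <-] dF.
have dc' : differentiable c 0 by exact/derivable1_diffP.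
have dFc : differentiable (F \o c) 0 by exact: differentiable_comp.
apply: DeriveDef; first exact: diff_derivable.
by rewrite deriveE // diff_comp //= deriveE.
Qed.

Lemma is_derive_scalel (s : C -> C) (ds : C) (M : 'M[C]_2) :
  is_derive (0 : C) (1 : C) s ds ->
  is_derive (0 : C) (1 : C) (fun t : C => s t *: M) (ds *: M).
Proof.
move=> [dc <-]; have dc' : differentiable s 0 by exact/derivable1_diffP.
have ds' : is_diff (0 : C) s ('d s 0) by exact: differentiableP.
have dFc := is_diff_comp ds' (is_diff_scalel (s 0) M).
have dF : differentiable (( *:%R ^~ M) \o s) (0 : C) by exact: ex_diff.
apply: DeriveDef; first exact: diff_derivable dF.
rewrite (deriveE _ dF) (@diff_val _ _ _ _ _ _ _ dFc) /=.
by rewrite deriveE.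
Qed.

Lemma is_derive_line (x v : 'M[C]_2) :
  is_derive (0 : C) (1 : C) (fun t : C => x + t *: v) v.
Proof.
rewrite -[v in X in is_derive _ _ _ X]scale1r -[X in is_derive _ _ _ X]add0r.
apply: is_deriveD; exact: is_derive_scalel.
Qed.

Lemma det_mx22 (K : comNzRingType) (A : 'M[K]_2) :
  \det A = A 0 0 * A 1 1 - A 0 1 * A 1 0.
Proof.
have e1 : lift ord0 ord0 = 1 :> 'I_2 by exact/val_inj.
have e0 : lift 1 ord0 = 0 :> 'I_2 by exact/val_inj.
rewrite (expand_det_row _ 0) !big_ord_recl big_ord0 /cofactor !det_mx11 !mxE.
by rewrite -!/ord0 !e1 ?e0 /= expr0 mul1r addr0 expr1 mulN1r mulrN.
Qed.

Lemma mxtrace22 (K : comNzRingType) (A : 'M[K]_2) : \tr A = A 0 0 + A 1 1.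
Proof.
by rewrite /mxtrace !big_ord_recl big_ord0 addr0; congr (_ + A _ _); exact/val_inj.
Qed.

Lemma det_tangent (X : 'M[C]_2) (a b : C) :
  \tr X = 0 -> \det (a%:M + b *: X) = a ^+ 2 + b ^+ 2 * \det X.
Proof.
rewrite !det_mx22 mxtrace22 !mxE /= mulr1n mulr0n.
by move/eqP; rewrite addr_eq0 => /eqP ->; ring.
Qed.

(* The curve is the Cayley transform g (1 + tX/2) (1 - tX/2)^-1. *)
Lemma diff_tangent (D : 'M[C]_2 -> C) (g : SL2) (X : 'M[C]_2) :
  \tr X = 0 -> differentiable D (SL2val g) -> (forall h : SL2, D h = 0) ->
  'd D (SL2val g) (SL2val g * X) = 0.
Proof.
move=> trX dD D0; pose u (t : C) : C := 1 + \det X / 4%:R * (t * t).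
have u0 : u 0 = 1 by rewrite /u mulr0 mulr0 addr0.
have du : is_derive (0 : C) (1 : C) u 0.
  have -> : u = cst 1 + (\det X / 4%:R) \*: ((id : C -> C) * id) by exact/funext.
  have H := is_deriveM (is_derive_id (0 : C) (1 : C)) (is_derive_id (0 : C) (1 : C)).
  have := is_deriveD (is_derive_cst (1 : C) (0 : C) (1 : C)) (is_deriveZ (\det X / 4%:R) H).
  by rewrite !scale0r !addr0 scaler0 addr0.
have dui : derivable (fun t : C => (u t)^-1) 0 1.
  by apply: derivableV; [rewrite u0 oner_neq0|exact: ex_derive].
pose b (t : C) : C := t * (u t)^-1.
have db : is_derive (0 : C) (1 : C) b 1.
  have -> : b = (id : C -> C) * (fun t : C => (u t)^-1) by exact/funext.
  have := is_deriveM (is_derive_id (0 : C) (1 : C)) (derivableP dui).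
  by rewrite scale0r add0r u0 invr1 scale1r.
pose a (t : C) : C := 1 - \det X / 2%:R * (t * b t).
have b0 : b 0 = 0 by rewrite /b mul0r.
have da : is_derive (0 : C) (1 : C) a 0.
  have -> : a = cst 1 - (\det X / 2%:R) \*: ((id : C -> C) * b) by exact/funext.
  have H := is_deriveM (is_derive_id (0 : C) (1 : C)) db.
  have := is_deriveB (is_derive_cst (1 : C) (0 : C) (1 : C)) (is_deriveZ (\det X / 2%:R) H).
  by rewrite scale0r b0 scale0r addr0 scaler0 subr0.
pose c (t : C) := a t *: SL2val g + b t *: (SL2val g * X).
have c0 : c 0 = SL2val g by rewrite /c /a b0 !mulr0 subr0 scale1r scale0r addr0.
have dc : is_derive (0 : C) (1 : C) c (SL2val g * X).
  rewrite -[X in is_derive _ _ _ X]add0r -[in X in is_derive _ _ _ X](scale0r (SL2val g)).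
  rewrite -[X in is_derive _ _ _ (_ + X)]scale1r.
  by apply: is_deriveD; exact: is_derive_scalel.
have := is_derive_path (F := D) dc; rewrite c0 => /(_ dD) dDc.
have nz : \forall t \near (0 : C), u t != 0.
  have cu : u t @[t --> (0 : C)] --> u 0.
    by apply/differentiable_continuous/derivable1_diffP; exact: ex_derive.
  by apply: (cvgr_neq0 _ cu); rewrite u0 oner_neq0.
have dz : is_derive (0 : C) (1 : C) (D \o c) 0.
  apply: (@near_eq_is_derive _ C C (cst (0 : C))).
  near=> t.
  have ut : u t != 0 by near: t.
  have cP : \det (c t) == 1.
    rewrite /c -[SL2val g in X in X + _]mulr1 scalerAr scalerAr -mulrDr scalemx1.
    rewrite [\det _]det_mulmx det_SL2 mul1r det_tangent //; apply/eqP.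
    rewrite /a /b; move: ut; rewrite /u; set d := \det X / 4%:R => ut.
    have -> : \det X = 4%:R * d by rewrite mulrC divfK // pnatr_eq0.
    have -> : 4%:R * d / 2%:R = 2%:R * d by field.
    by field; exact: ut.
  by rewrite /= -[c t]/(SL2val (MkSL2 cP)) D0.
by rewrite -(@derive_val _ _ _ _ _ _ _ dDc) (@derive_val _ _ _ _ _ _ _ dz).
Unshelve. all: by end_near.
Qed.

Lemma vf_actP (Phi : vfield) (f : regfun) (F : 'M[C]_2 -> C) :
  (forall g : SL2, differentiable F (SL2val g)) -> (forall g : SL2, F g = f g) ->
  forall g : SL2,
    is_derive (0 : C) (1 : C) (fun t : C => F (SL2val g + t *: (SL2val g * Phi g)))
      (vf_act Phi f g).
Proof.
move=> dF eF g; set v := SL2val g * Phi g.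
have line (G : 'M[C]_2 -> C) : differentiable G (SL2val g) ->
    is_derive (0 : C) (1 : C) (fun t : C => G (SL2val g + t *: v)) ('d G (SL2val g) v).
  move=> dG; have := is_derive_path (F := G) (is_derive_line (SL2val g) v).
  by rewrite scale0r addr0; exact.
have dE : differentiable (ext f) (SL2val g) by exact: differentiable_mxeval.
rewrite /vf_act derive1E -/v (@derive_val _ _ _ _ _ _ _ (line _ dE)).
have eD : 'd F (SL2val g) v - 'd (ext f) (SL2val g) v = 0.
  rewrite -[LHS]/(('d F (SL2val g) \- 'd (ext f) (SL2val g)) v) -diffB //.
  apply: diff_tangent; [exact: vfield_tr | exact: differentiableB |].
  by move=> h; rewrite -[LHS]/(F h - ext f h) eF extE subrr.
by move/subr0_eq: eD => <-; exact: line.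
Qed.

End SL2.

Section EndTrace.
Variables (F : fieldType) (V : vectType F).

Definition end_trace (f : 'End(V)) : F :=
  \tr (passmx.mxof (vbasis {:V}) (vbasis {:V}) f).

Lemma end_trace_basis (e : (\dim {:V}).-tuple V) (f : 'End(V)) :
  basis_of {:V} e -> end_trace f = \tr (passmx.mxof e e f).
Proof.
move=> be; have bb : basis_of {:V} (vbasis {:V}) by exact: vbasisP.
rewrite /end_trace -{1}(comp_lfun1l f) (passmx.mxof_comp _ _ be) mxtrace_mulC.
by rewrite -passmx.mxof_comp // comp_lfun1r.
Qed.

Lemma end_traceC (f g : 'End(V)) : end_trace (f \o g)%VF = end_trace (g \o f)%VF.
Proof.
by rewrite /end_trace !(passmx.mxof_comp _ _ (vbasisP _)) mxtrace_mulC.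
Qed.

Lemma end_traceE (f : 'End(V)) :
  end_trace f = \sum_i coord (vbasis {:V}) i (f (vbasis {:V})`_i).
Proof.
apply: eq_bigr => i _; rewrite /passmx.mxof /lin1_mx !mxE /=.
by rewrite passmx.vecof_delta.
Qed.

End EndTrace.

(* S^n V for V = F^2 with basis e_0, e_1: the homogeneous polynomials of
   degree n in e_0 = 'X_0 and e_1 = 'X_1, on which a matrix A acts by
   substituting A e_j = \sum_i A_ij e_i for e_j. *)
Section SymPow.
Variable F : fieldType.

Definition mx_forms (A : 'M[F]_2) : 2.-tuple (mpoly 2 F) :=
  [tuple \sum_(i < 2) A i j *: mpolyX F (mnm1 i) | j < 2].

Lemma sym_pow_subproof n (A : 'M[F]_2) (p : dhomog 2 F n) :
  comp_mpoly (mx_forms A) p \is @ishomog1 2 F n mdeg.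
Proof.
rewrite comp_mpolyE big_seq rpred_sum // => m mp; apply/rpredZ.
have <- : mdeg m = n by exact: (dhomog_mf (dhomog_is_dhomog p) mp).
rewrite mdegE.
elim: (index_enum _) => [|j s IHs]; first by rewrite !big_nil dhomog1.
rewrite !big_cons dhomogM // -[X in ishomog1 X]mul1n dhomogMn // tnth_mktuple.
by rewrite rpred_sum // => i _; apply/rpredZ; rewrite dhomogX /= mdeg1.
Qed.

Definition sym_pow_fun n (A : 'M[F]_2) (p : dhomog 2 F n) : dhomog 2 F n :=
  DHomog (sym_pow_subproof A p).

Lemma sym_pow_fun_linear n A : linear (@sym_pow_fun n A).
Proof. by move=> c p q; apply/val_inj; rewrite /= linearP. Qed.

HB.instance Definition _ n A :=
  GRing.isLinear.Build F (dhomog 2 F n) (dhomog 2 F n) _ (@sym_pow_fun n A)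
    (@sym_pow_fun_linear n A).

Definition sym_pow n (A : 'M[F]_2) : 'End(dhomog 2 F n) := linfun (@sym_pow_fun n A).

Lemma sym_powE n A (p : dhomog 2 F n) :
  mpoly_of_dhomog (sym_pow n A p) = comp_mpoly (mx_forms A) p.
Proof. by rewrite lfunE. Qed.

Lemma comp_mx_forms (A B : 'M[F]_2) (p : mpoly 2 F) :
  comp_mpoly (mx_forms A) (comp_mpoly (mx_forms B) p)
  = comp_mpoly (mx_forms (A * B)) p.
Proof.
rewrite [comp_mpoly _ p in LHS]comp_mpolyE [RHS]comp_mpolyE linear_sum /=.
apply: eq_bigr => m _; rewrite linearZ rmorph_prod /=; congr (_ *: _).
apply: eq_bigr => j _; rewrite rmorphXn /= !tnth_mktuple linear_sum /=.
congr (_ ^+ _); under eq_bigr => i _ do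
  rewrite linearZ /= comp_mpolyXU -tnth_nth tnth_mktuple scaler_sumr.
rewrite exchange_big /=; apply: eq_bigr => k _.
under eq_bigr do rewrite scalerA.
by rewrite -scaler_suml mxE; congr (_ *: _); apply: eq_bigr => i _; rewrite mulrC.
Qed.

Lemma sym_powM n A B : sym_pow n (A * B) = (sym_pow n A \o sym_pow n B)%VF.
Proof.
by apply/lfunP => p; apply/val_inj; rewrite comp_lfunE /= !sym_powE comp_mx_forms.
Qed.

Lemma sym_pow1 n : sym_pow n 1 = \1%VF.
Proof.
apply/lfunP => p; apply/val_inj; rewrite id_lfunE /= sym_powE.
rewrite -[RHS]comp_mpoly_id; congr comp_mpoly; apply: eq_from_tnth => j.
rewrite !tnth_mktuple (bigD1 j) //= big1 ?addr0 => [|i ij].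
  by rewrite mxE eqxx scale1r.
by rewrite mxE (negPf ij) scale0r.
Qed.

End SymPow.

Section Invariants.
Variable R : realType.
Local Notation C := (Cx R).
Local Notation SL2 := (SL2 R).
Implicit Types (f h : SL2 -> C) (g : SL2).

Lemma regular_cst (c : C) : regular_fun (fun _ : SL2 => c).
Proof. by exists (mpolyC _ c) => g; rewrite /mxeval mevalC. Qed.

Lemma regular_coord i j : regular_fun (fun g => SL2val g i j).
Proof. by exists (mpolyX _ (mnm1 (mxvec_index i j))) => g; rewrite /mxeval mevalXU mxvecE. Qed.

Lemma regularD f h : regular_fun f -> regular_fun h -> regular_fun (fun g => f g + h g).
Proof. by move=> [P fP] [Q hQ]; exists (P + Q) => g; rewrite /mxeval mevalD fP hQ. Qed.

Lemma regularM f h : regular_fun f -> regular_fun h -> regular_fun (fun g => f g * h g).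
Proof. by move=> [P fP] [Q hQ]; exists (P * Q) => g; rewrite /mxeval mevalM fP hQ. Qed.

Lemma regularN f : regular_fun f -> regular_fun (fun g => - f g).
Proof. by move=> [P fP]; exists (- P) => g; rewrite /mxeval mevalN fP. Qed.

Lemma regularX f n : regular_fun f -> regular_fun (fun g => f g ^+ n).
Proof. by move=> [P fP]; exists (P ^+ n) => g; rewrite /mxeval rmorphXn /= fP. Qed.

Lemma regular_sum I (r : seq I) (P : pred I) (F : I -> SL2 -> C) :
  (forall i, regular_fun (F i)) -> regular_fun (fun g => \sum_(i <- r | P i) F i g).
Proof.
move=> rF; elim: r => [|i r IH].
  by under eq_fun do rewrite big_nil; exact: regular_cst.
under eq_fun do rewrite big_cons.
by case: (P i) => //; exact: regularD.
Qed.

Definition mxregular (A : SL2 -> 'M[C]_2) := forall i j, regular_fun (fun g => A g i j).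

Lemma mxregularM A B : mxregular A -> mxregular B -> mxregular (fun g => A g * B g).
Proof.
move=> rA rB i j; under eq_fun do rewrite mxE.
by apply: regular_sum => k; exact: regularM.
Qed.

Lemma mxregularX A n : mxregular A -> mxregular (fun g => A g ^+ n).
Proof.
move=> rA; elim: n => [|n IH] i j.
  by under eq_fun do rewrite expr0; exact: regular_cst.
by under eq_fun do rewrite exprS; exact: mxregularM.
Qed.

Lemma regular_tr A : mxregular A -> regular_fun (fun g => \tr (A g)).
Proof. by move=> rA; exact: regular_sum. Qed.

Lemma invr22 (A : 'M[C]_2) : \det A = 1 -> A^-1 = (\tr A)%:M - A.
Proof.
move=> dA; have uA : A \is a GRing.unit.
  by rewrite -[_ \is a _]/(A \in unitmx) unitmxE dA unitr1.
apply: (mulrI uA); rewrite divrr // mulrBr; apply/matrixP => i j.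
have o2 (k : 'I_2) : k = 0 \/ k = 1.
  by case: k => -[|[|//]] ?; [left|right]; exact/val_inj.
rewrite !mxE !big_ord_recl !big_ord0 !mxE.
have -> : lift ord0 ord0 = 1 :> 'I_2 by exact/val_inj.
rewrite -!/ord0 mxtrace22; move: dA; rewrite det_mx22.
case: (o2 i) => ->; case: (o2 j) => -> /=; rewrite ?mulr1n ?mulr0n => dA.
- by rewrite -dA; ring.
- by ring.
- by ring.
- by rewrite -dA; ring.
Qed.

Lemma mxtraceV22 (A : 'M[C]_2) : \det A = 1 -> \tr A^-1 = \tr A.
Proof.
by move=> dA; rewrite invr22 // raddfB /= mxtrace_scalar mulr2n addrK.
Qed.

Lemma mxregular_SL2X (m : int) : mxregular (fun g => SL2val g ^ m).
Proof.
have r1 : mxregular (fun g => SL2val g) by move=> i j; exact: regular_coord.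
case: m => n; first exact: mxregularX.
under eq_fun do rewrite NegzE -exprz_inv -exprnP.
apply: mxregularX => i j.
under eq_fun => g do rewrite invr22 ?det_SL2 // !mxE.
apply: regularD; last by apply: regularN; exact: regular_coord.
case: (i == j); under eq_fun do rewrite ?mulr1n ?mulr0n.
  exact: regular_tr.
exact: regular_cst.
Qed.

Lemma conj_SL2X (h g : SL2) (m : int) :
  SL2val (conj_SL2 h g) ^ m = SL2val h * SL2val g ^ m * (SL2val h)^-1.
Proof.
have uh := SL2_unit h; have ug := SL2_unit g.
have H (n : nat) : SL2val (conj_SL2 h g) ^+ n = SL2val h * SL2val g ^+ n * (SL2val h)^-1.
  elim: n => [|n IH]; first by rewrite !expr0 mulr1 divrr.
  by rewrite !exprSr IH /= !mulrA mulrVK.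
case: m => n; first exact: H.
rewrite NegzE -!exprnN H !invrM ?unitrM ?unitrV ?unitrX ?uh //.
  by rewrite invrK mulrA.
by rewrite unitrMl ?unitrX.
Qed.

Lemma mxtrace_conj (h : SL2) (A : 'M[C]_2) : \tr (SL2val h * A * (SL2val h)^-1) = \tr A.
Proof. by rewrite [LHS]mxtrace_mulC -[_ *m _]/((SL2val h)^-1 * (SL2val h * A)) mulKr ?SL2_unit. Qed.

Lemma Psi_tr (k : nat) g : \tr (SL2val g ^ k%:Z - SL2val g ^ (- k%:Z)) = 0.
Proof.
rewrite raddfB /= -invr_expz mxtraceV22 ?subrr // -exprnP.
by elim: k => [|k IH]; rewrite ?expr0 ?det1 // exprS [LHS]det_mulmx IH det_SL2 mulr1.
Qed.

Lemma Psi_reg (k : nat) i j :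
  regular_fun (fun g => (SL2val g ^ k%:Z - SL2val g ^ (- k%:Z)) i j).
Proof.
under eq_fun do rewrite !mxE.
by apply: regularD; [|apply: regularN]; exact: mxregular_SL2X.
Qed.

Lemma Psi_conj (k : nat) (h g : SL2) :
  SL2val (conj_SL2 h g) ^ k%:Z - SL2val (conj_SL2 h g) ^ (- k%:Z)
  = SL2val h * (SL2val g ^ k%:Z - SL2val g ^ (- k%:Z)) * (SL2val h)^-1.
Proof. by rewrite !conj_SL2X mulrBr mulrBl. Qed.

Definition Psi (k : nat) : vfield R := VField (Psi_tr k) (Psi_reg k) (Psi_conj k).

Definition Ifun (m : int) : SL2 -> C := fun g => \tr (SL2val g ^ m).

Lemma Ifun_regular m : regular_fun (Ifun m).
Proof. exact/regular_tr/mxregular_SL2X. Qed.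

Lemma Ifun_conj m (h g : SL2) : Ifun m (conj_SL2 h g) = Ifun m g.
Proof. by rewrite /Ifun conj_SL2X mxtrace_conj. Qed.

Definition I_ (m : int) : adinvfun R :=
  AdInvFun (adinvfun_val := RegFun (Ifun_regular m)) (Ifun_conj m).

Definition Jfun (m : nat) : SL2 -> C := fun g => \tr (SL2val g) ^+ m.

Lemma Jfun_regular m : regular_fun (Jfun m).
Proof. by apply/regularX/regular_tr => i j; exact: regular_coord. Qed.

Lemma Jfun_conj m (h g : SL2) : Jfun m (conj_SL2 h g) = Jfun m g.
Proof. by rewrite /Jfun mxtrace_conj. Qed.

Definition J_ (m : nat) : adinvfun R :=
  AdInvFun (adinvfun_val := RegFun (Jfun_regular m)) (Jfun_conj m).

(* Only chi_(-1) = 0 is meaningful among the negative indices. *)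
Definition chifun (m : int) : SL2 -> C := fun g =>
  if m is Posz n then end_trace (sym_pow n (SL2val g)) else 0.

Lemma regular_coeff_forms (p : mpoly 2 C) mu :
  regular_fun (fun g => mcoeff mu (comp_mpoly (mx_forms (SL2val g)) p)).
Proof.
pose good (q : SL2 -> mpoly 2 C) := forall nu, regular_fun (fun g => mcoeff nu (q g)).
have goodM q r : good q -> good r -> good (fun g => q g * r g).
  move=> gq gr nu; under eq_fun do rewrite mcoeffM.
  by apply: regular_sum => k; exact: regularM.
have good1 : good (fun=> 1) by move=> nu; exact: regular_cst.
have goodX q n : good q -> good (fun g => q g ^+ n).
  move=> gq; elim: n => [|n IH] nu.
    by under eq_fun do rewrite expr0.
  by under eq_fun do rewrite exprS; exact: goodM.
under eq_fun do rewrite comp_mpolyE linear_sum /=.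
apply: regular_sum => m; under eq_fun do rewrite mcoeffZ.
apply: regularM; first exact: regular_cst.
move: mu; elim: (index_enum _) => [|j s IHs] mu.
  by under eq_fun do rewrite big_nil; exact: good1.
under eq_fun do rewrite big_cons.
apply: goodM IHs mu; apply: goodX => nu.
under eq_fun do rewrite tnth_mktuple linear_sum /=.
apply: regular_sum => i; under eq_fun do rewrite mcoeffZ.
by apply: regularM; [exact: regular_coord|exact: regular_cst].
Qed.

Lemma dhomog_sumE n (L : {linear dhomog 2 C n -> C^o}) (q : dhomog 2 C n) :
  L q = \sum_(m : bmultinom 2 n.+1) mcoeff m q * L (indhomog n (mpolyX C m)).
Proof.
have {1}-> : q = \sum_(m : bmultinom 2 n.+1) mcoeff m q *: indhomog n (mpolyX C m).
  apply/val_inj; rewrite -[RHS]/(mpoly_of_dhomog _) linear_sum /=.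
  have qn : (mmeasure mdeg q <= n.+1)%N.
    rewrite mmeasureE; apply/bigmax_leqP_seq => m mq _.
    by rewrite ltnS (dhomog_mf (dhomog_is_dhomog q) mq).
  rewrite {1}(mpolywE qn); apply: eq_bigr => m _.
  have [mn|mn] := eqVneq (mdeg m) n.
    rewrite /indhomog insubdK // -[_ \in _]/(mpolyX C m \is @ishomog1 2 C n mdeg).
    by rewrite dhomogX; apply/eqP.
  by rewrite (dhomog_nemf_coeff (dhomog_is_dhomog q) mn) !scale0r.
by rewrite linear_sum /=; apply: eq_bigr => m _; rewrite linearZ.
Qed.

Lemma chifun_regular m : regular_fun (chifun m).
Proof.
case: m => n; last exact: regular_cst.
rewrite /chifun; under eq_fun do rewrite end_traceE.
apply: regular_sum => i; under eq_fun do rewrite dhomog_sumE.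
apply: regular_sum => m; apply: regularM; last exact: regular_cst.
under eq_fun do rewrite sym_powE; exact: regular_coeff_forms.
Qed.

Lemma chifun_conj m (h g : SL2) : chifun m (conj_SL2 h g) = chifun m g.
Proof.
case: m => n //=; rewrite sym_powM end_traceC -sym_powM.
by rewrite mulKr ?SL2_unit.
Qed.

Definition chi_ (m : int) : adinvfun R :=
  AdInvFun (adinvfun_val := RegFun (chifun_regular m)) (chifun_conj m).

End Invariants.

Arguments Psi {R} k.
Arguments I_ {R} m.
Arguments J_ {R} m.
Arguments chi_ {R} m.

(* Main.v *)
(* The chi_n satisfy the Chebyshev recurrence in t = tr g: for a triangular
   matrix with diagonal (a, d), ad = 1, the trace on S^n V is the sum of
   a^i d^(n-i), read off from the monomial basis, and every g is conjugate to
   such a matrix. Hence chi_n, like J_n, is a polynomial in t, on which Psi_1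
   acts as (t^2 - 4) d/dt; the formula for chi_n is then an identity between
   Chebyshev polynomials. For I_m, the direction V = g Psi_k(g) commutes with g,
   so the binomial formula gives the linear term of tr((g + tV)^m). *)
Require Import Defs.
From mathcomp Require Import all_boot all_order all_algebra.
From mathcomp Require Import all_classical all_reals all_analysis.
From mathcomp Require Import complex ring.
From mathcomp Require Import -(notations) mpoly.

Set Implicit Arguments.
Unset Strict Implicit.
Unset Printing Implicit Defensive.

Import Order.TTheory GRing.Theory Num.Theory numFieldNormedType.Exports.
Local Open Scope ring_scope.

(* The Chebyshev polynomials U_n, rescaled so that U_n(a + a^-1) is
   (a^(n+1) - a^-(n+1)) / (a - a^-1). *)
Fixpoint chebU (F : comNzRingType) (n : nat) : {poly F} :=
  if n is n1.+1 then if n1 is n2.+1 then 'X * chebU F n1 - chebU F n2 else 'X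
  else 1.

Lemma chebUSS (F : comNzRingType) n : chebU F n.+2 = 'X * chebU F n.+1 - chebU F n.
Proof. by []. Qed.

(** Differentiating the recurrence expresses each derivative through the two preceding ones, so two
    consecutive cases are carried together. With m = [n.+1] the coefficients are the m and m + 2 of
    Psi_1(chi_m). *)
Lemma chebU_deriv (F : comNzRingType) n :
  ('X ^+ 2 - 4%:R) * (chebU F n.+1)^`()
  = n.+1%:R * chebU F n.+2 - n.+3%:R * chebU F n.
Proof.
suff [] : ('X ^+ 2 - 4%:R) * (chebU F n.+1)^`()
    = n.+1%:R * chebU F n.+2 - n.+3%:R * chebU F n /\
  ('X ^+ 2 - 4%:R) * (chebU F n.+2)^`()
    = n.+2%:R * chebU F n.+3 - n.+4%:R * chebU F n.+1 by [].
elim: n => [|n [IH1 IH2]].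
  by split; rewrite /= ?derivB ?derivM ?derivX ?derivC ?deriv1; ring.
split=> //; rewrite [in LHS]chebUSS derivB derivM derivX.
transitivity (('X ^+ 2 - 4%:R) * chebU F n.+2
    + 'X * (('X ^+ 2 - 4%:R) * (chebU F n.+2)^`())
    - ('X ^+ 2 - 4%:R) * (chebU F n.+1)^`()).
  move: (chebU F n.+1) (chebU F n.+2) => u v; ring.
rewrite {}IH2 {}IH1 !chebUSS; move: (chebU F n.+1) (chebU F n) => u v; ring.
Qed.

Lemma sum_expr_recr (F : comNzRingType) (a d : F) n :
  \sum_(i < n.+2) a ^+ i * d ^+ (n.+1 - i)
  = d * (\sum_(i < n.+1) a ^+ i * d ^+ (n - i)) + a ^+ n.+1.
Proof.
rewrite big_ord_recr /= subnn mulr1 mulr_sumr; congr (_ + _).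
by apply: eq_bigr => i _; rewrite subSn ?leq_ord // exprS mulrCA.
Qed.

(** The complete homogeneous sums satisfy h_(n+2) = (a + d) h_(n+1) - a d h_n, which is the
    recurrence of [chebU] at a + d once a d = 1. *)
Lemma chebU_sum (F : comNzRingType) (a d : F) n : a * d = 1 ->
  (chebU F n).[a + d] = \sum_(i < n.+1) a ^+ i * d ^+ (n - i).
Proof.
move=> ad; pose S n := \sum_(i < n.+1) a ^+ i * d ^+ (n - i).
suff [] : (chebU F n).[a + d] = S n /\ (chebU F n.+1).[a + d] = S n.+1 by [].
elim: n => [|n [IH1 IH2]].
  by rewrite /S !big_ord_recl !big_ord0 /= !hornerE /=; split; ring.
split=> //; rewrite chebUSS !hornerE IH1 IH2.
rewrite /S [X in _ = X]sum_expr_recr sum_expr_recr exprS.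
(* Giving the subtracted sum the factor 1 = [a * d] leaves an identity valid in every commutative
   ring. *)
rewrite -[X in _ - X]mul1r -ad [a ^+ n.+2]exprS [a ^+ n.+1]exprS.
ring.
Qed.

Lemma horner_chebU_deriv (F : comNzRingType) n (x : F) :
  (x ^+ 2 - 4%:R) * (chebU F n.+1)^`().[x]
  = n.+1%:R * (chebU F n.+2).[x] - n.+3%:R * (chebU F n).[x].
Proof.
have /(congr1 (horner^~ x)) := chebU_deriv F n.
move: (chebU F n.+1)^`() (chebU F n.+2) (chebU F n) => u v w.
by rewrite -!polyC_natr !(hornerXn, hornerM, hornerD, hornerN, hornerC).
Qed.

(** Turns the derivatives at t = 0 below into computations with formal polynomials. *)
Lemma is_derive_horner (K : numFieldType) (p : {poly K}) (x : K) :
  is_derive x (1 : K) (horner p) p^`().[x].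
Proof.
elim/poly_ind: p => [|p c IH].
  rewrite deriv0 horner0 (_ : horner 0 = cst (0 : K)); first exact: is_derive_cst.
  by apply/funext => y; rewrite horner0.
have -> : horner (p * 'X + c%:P) = (horner p : K -> K) * (id : K -> K) + cst c.
  by apply/funext => y; rewrite !hornerE.
have H := is_deriveM IH (is_derive_id x (1 : K)).
rewrite (_ : (p * 'X + c%:P)^`().[x] = p.[x] *: 1 + x *: p^`().[x] + 0).
  exact: is_deriveD H (is_derive_cst c x (1 : K)).
by rewrite !poly.derivE !hornerE /= /GRing.scale /=; ring.
Qed.

(** * Monomials in two variables and triangular substitutions *)

Definition mnm_pair (i j : nat) : multinom 2 :=
  Multinom [tuple if k == 0 then i else j | k < 2].

(** This is a diagonal entry of S^(i+j) of a lower triangular matrix. In the binomial expansion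
    every factor c e_1 lowers the exponent of e_0, so only the term a^i e_0^i contributes. *)
Lemma mcoeff_binary_trig (F : comNzRingType) (a c d : F) (i j : nat) :
  mcoeff (mnm_pair i j)
    ((a *: mpolyX F (mnm1 (0 : 'I_2)) + c *: mpolyX F (mnm1 1)) ^+ i
      * (d *: mpolyX F (mnm1 1)) ^+ j) = a ^+ i * d ^+ j.
Proof.
have E (l : nat) : mcoeff (mnm_pair i j)
   ((a *: mpolyX F (mnm1 (0 : 'I_2))) ^+ (i - l) * (c *: mpolyX F (mnm1 1)) ^+ l
      * (d *: mpolyX F (mnm1 1)) ^+ j)
   = a ^+ (i - l) * c ^+ l * d ^+ j
     * (mnm_add (mnm_add (mnm_muln (mnm1 0) (i - l)) (mnm_muln (mnm1 1) l))
                (mnm_muln (mnm1 1) j) == mnm_pair i j)%:R.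
  rewrite !exprZn !mpolyXn -!scalerAl -!scalerAr -!scalerAl -!mpolyXD.
  by rewrite !scalerA mcoeffZ mcoeffX; congr (_ * _); ring.
rewrite exprDn mulr_suml linear_sum big_ord_recl /= big1 => [|l _].
  rewrite bin0 mulr1n E subn0 expr0 mulr1 addr0.
  rewrite (_ : _ == _) ?mulr1 //; apply/eqP/mnmP => k.
  rewrite !mnmDE !mulmnE !mnm1E mnmE.
  by case: k => -[|[|//]] ?; rewrite /= ?muln0 ?mul0n ?muln1 ?mul1n ?addn0 ?add0n.
rewrite mulrnAl linearMn /= E (_ : _ == _ = false) ?mulr0 ?mul0rn //.
apply/negbTE/eqP => /mnmP /(_ 0).
rewrite !mnmDE !mulmnE !mnm1E mnmE /=.
rewrite ?mul0n ?mul1n ?muln0 ?muln1 ?addn0 /bump /= => H.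
(* Truncated subtraction is strictly decreasing here because [l < i] forces [0 < i]. *)
have : (i - (1 + l) < i)%N by rewrite ltn_subrL (leq_ltn_trans _ (ltn_ord l)).
by rewrite H ltnn.
Qed.

Lemma mnm_pairK (m : multinom 2) : mnm_pair (m 0) (m 1) = m.
Proof.
apply/mnmP => k; rewrite mnmE.
by case: k => -[|[|//]] ? /=; congr (m _); exact/val_inj.
Qed.

Lemma mdeg_mnm_pair i j : mdeg (mnm_pair i j) = (i + j)%N.
Proof. by rewrite mdegE !big_ord_recl big_ord0 !mnmE addn0. Qed.

Lemma bmnm_pair_proof n (i : 'I_n.+1) : (mdeg (mnm_pair i (n - i)) < n.+1)%N.
Proof. by rewrite mdeg_mnm_pair subnKC // leq_ord. Qed.

(** Enumerates the multinomials of degree exactly n inside the index type of [dhomog_sumE], which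
    holds all degrees up to n. *)
Definition bmnm_pair n (i : 'I_n.+1) : bmultinom 2 n.+1 :=
  BMultinom (bmnm_pair_proof i).

(** * Action of a vector field on functions of the trace and on traces of powers *)

Section InvariantFunctions.
Variable R : realType.
Local Notation C := (Cx R).

Lemma differentiable_mxtrace (F : 'M[C]_2 -> 'M[C]_2) (x : 'M[C]_2) :
  (forall i, differentiable (fun y => F y i i : C) x) ->
  differentiable (fun y => \tr (F y) : C) x.
Proof.
move=> dF; under eq_fun do rewrite mxtrace22.
exact: differentiableD.
Qed.

Lemma differentiable_expmx (n : nat) (x : 'M[C]_2) i j :
  differentiable (fun y : 'M[C]_2 => (y ^+ n) i j : C) x.
Proof.
elim: n i j => [|n IH] i j.
  by under eq_fun do rewrite expr0; exact: differentiable_cst.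
under eq_fun do rewrite exprS mxE !big_ord_recl big_ord0 addr0.
apply: differentiableD; apply: differentiableM => //;
  exact: differentiable_coord.
Qed.

(** The trace is affine along the line g + tv, so the extension p(tr y) restricts to a polynomial in
    t; its formal derivative at 0 is the chain rule. *)
Lemma vf_act_horner (Phi : vfield R) (f : regfun R) (p : {poly C}) (g : SL2 R) :
  (forall h : SL2 R, f h = p.[\tr (SL2val h)]) ->
  vf_act Phi f g = p^`().[\tr (SL2val g)] * \tr (SL2val g * Phi g).
Proof.
move=> fp; set v := SL2val g * Phi g.
have dtr (x : 'M[C]_2) : differentiable (fun y : 'M[C]_2 => \tr y : C) x.
  by apply: differentiable_mxtrace => i; exact: differentiable_coord.
have dF (x : 'M[C]_2) : differentiable (fun y : 'M[C]_2 => p.[\tr y] : C) x.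
  have dp : differentiable (horner p : C -> C) (\tr x).
    by apply/derivable1_diffP; have [] := is_derive_horner p (\tr x).
  exact: (differentiable_comp (dtr x) dp).
have := vf_actP Phi (fun h => dF (SL2val h)) (fun h => esym (fp h)) g.
rewrite -/v => H1.
have H2 := is_derive_horner (p \Po ((\tr (SL2val g))%:P + (\tr v) *: 'X)) (0 : C).
have E : horner (p \Po ((\tr (SL2val g))%:P + (\tr v) *: 'X))
    = (fun t : C => p.[\tr (SL2val g + t *: v)]).
  by apply/funext => t; rewrite horner_comp !hornerE raddfD /= mxtraceZ mulrC.
rewrite E in H2.
rewrite -(@derive_val _ _ _ _ _ _ _ H1) (@derive_val _ _ _ _ _ _ _ H2).
rewrite deriv_comp !hornerM horner_comp !poly.derivE !hornerE /=.
by rewrite mulr1.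
Qed.

Lemma vf_act_trX (Phi : vfield R) (f : regfun R) (m : nat) (g : SL2 R) :
  (forall h : SL2 R, f h = \tr (SL2val h ^+ m)) ->
  GRing.comm (SL2val g) (Phi g) ->
  vf_act Phi f g = m%:R * \tr (SL2val g ^+ m * Phi g).
Proof.
move=> fE cg; set v := SL2val g * Phi g.
have cv : GRing.comm (SL2val g) v by apply: commrM.
have dF (h : SL2 R) :
    differentiable (fun y : 'M[C]_2 => \tr (y ^+ m) : C) (SL2val h).
  by apply: differentiable_mxtrace => i; exact: differentiable_expmx.
have H1 := vf_actP Phi dF (fun h => esym (fE h)) g.
rewrite -/v in H1.
(* These are the coefficients in t of tr((g + tv)^m), so the derivative at 0 is [c 1], that is m
   tr(g^(m-1) v) with v = g Phi(g). *)
pose c i : C := \tr (SL2val g ^+ (m - i) * v ^+ i *+ 'C(m, i)).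
have H2 := is_derive_horner (\poly_(i < m.+1) c i) (0 : C).
have E : horner (\poly_(i < m.+1) c i)
    = (fun t : C => \tr ((SL2val g + t *: v) ^+ m)).
  apply/funext => t; rewrite horner_poly exprDn_comm; last first.
    by rewrite /GRing.comm -scalerAl -scalerAr cv.
  rewrite raddf_sum /=; apply: eq_bigr => i _.
  by rewrite exprZn -scalerAr mulrC -mxtraceZ scalerMnr.
rewrite E in H2.
rewrite -(@derive_val _ _ _ _ _ _ _ H1) (@derive_val _ _ _ _ _ _ _ H2).
rewrite horner_coef0 coef_deriv coef_poly mulr1n.
(* For [m = 0] the coefficient of index 1 is out of range, hence 0. *)
case: m {fE dF H1 H2 E} @c => [|m] c; first by rewrite mul0r.
rewrite /= /c bin1 subn1 /= expr1 mulrA -exprSr raddfMn /= mulr_natl //.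
Qed.

(** * Traces on symmetric powers *)

(** Expanding the images of the abstract basis in monomials, and the monomials in that basis, gives
    the same double sum. Indices of degree below n are harmless: [indhomog] sends their monomials to
    0. *)
Lemma end_trace_dhomog n (f : 'End(dhomog 2 C n)) :
  end_trace f = \sum_(m : bmultinom 2 n.+1)
    mcoeff m (mpoly_of_dhomog (f (indhomog n (mpolyX C m)))).
Proof.
rewrite end_traceE; set b := vbasis _.
under eq_bigr => i _ do rewrite (dhomog_sumE (coord b i)).
rewrite exchange_big /=; apply: eq_bigr => m _.
rewrite [in RHS](coord_vbasis (memvf (indhomog n (mpolyX C m)))).
rewrite linear_sum /= linear_sum /= linear_sum /=.
apply: eq_bigr => i _; rewrite mulrC.
by do 2 rewrite linearZ /=.
Qed.

Lemma end_trace_sym_pow_trig n (A : 'M[C]_2) : A 0 1 = 0 ->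
  end_trace (sym_pow n A) = \sum_(i < n.+1) A 0 0 ^+ i * A 1 1 ^+ (n - i).
Proof.
move=> A01; rewrite end_trace_dhomog.
rewrite (bigID (fun m : bmultinom 2 n.+1 => mdeg m == n)) /=.
rewrite [X in _ + X]big1 ?addr0; last first.
  move=> m mn; rewrite /indhomog /insubd insubF ?linear0 ?mcoeff0 //=.
  apply/negbTE; apply: contra mn => mn.
  have mX : mpolyX C m \is @ishomog1 2 C n mdeg by exact: mn.
  by apply/eqP/(dhomog_mf mX); rewrite msuppX mem_head.
(* The surviving monomials are e_0^i e_1^(n-i), recovered from the exponent of e_0. *)
have bij : {on [pred m : bmultinom 2 n.+1 | mdeg m == n],
    bijective (@bmnm_pair n)}.
  exists (fun m : bmultinom 2 n.+1 => inord (m 0)) => [i _|m /eqP mn].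
    by apply/val_inj; rewrite /= mnmE inord_val.
  have m01 : (m (0%R : 'I_2) + m (1%R : 'I_2) = n)%N.
    by rewrite -mdeg_mnm_pair mnm_pairK.
  apply/val_inj; rewrite /= inordK; last by rewrite ltnS -[leqRHS]m01 leq_addr.
  by rewrite -[X in (X - _)%N]m01 addKn mnm_pairK.
rewrite (reindex _ bij).
apply: eq_big => [i|i _] /=; first by rewrite mdeg_mnm_pair subnKC ?eqxx // leq_ord.
rewrite /= sym_powE /indhomog insubdK; last first.
  rewrite -[_ \in _]/(mpolyX C (mnm_pair i (n - i)) \is @ishomog1 2 C n mdeg).
  by rewrite dhomogX /= mdeg_mnm_pair subnKC // leq_ord.
rewrite comp_mpolyX !big_ord_recl big_ord0 mulr1 !tnth_mktuple.
rewrite !big_ord_recl !big_ord0 !addr0.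
rewrite !mnmE /= (_ : lift ord0 ord0 = 1); last exact/val_inj.
by rewrite A01 scale0r add0r mcoeff_binary_trig.
Qed.

Lemma chifunE (n : nat) (g : SL2 R) : chi_ n g = (chebU C n).[\tr (SL2val g)].
Proof.
rewrite /= /chifun.
(* Schur triangularization uses that the field is algebraically closed. Its [P] is unitary, perhaps
   not of determinant 1, so conjugation invariance is rederived from [sym_powM] and [end_traceC]
   instead of [chifun_conj]. *)
have [P Pu tr] :=
  @Schur (R[i]%C : numClosedFieldType) 2 (SL2val g : 'M[R[i]%C]_2) isT.
have uP : P \in unitmx by exact: unitarymx_unit.
move: tr => /is_trig_mxP tr; have := tr 0 1 isT.
rewrite conjumx //.
set A : 'M[C]_2 := _ *m invmx P => A01.
have PU : (P : 'M[C]_2) \is a GRing.unit by exact: uP.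
have AE : A = (P : 'M[C]_2) * SL2val g * (P : 'M[C]_2)^-1 by [].
have -> : end_trace (sym_pow n (SL2val g)) = end_trace (sym_pow n A).
  by rewrite AE sym_powM end_traceC -sym_powM mulKr.
have -> : \tr (SL2val g) = A 0 0 + A 1 1.
  rewrite -mxtrace22 AE [RHS]mxtrace_mulC.
  by rewrite -[_ *m _]/((P : 'M[C]_2)^-1 * ((P : 'M[C]_2) * SL2val g)) mulKr.
rewrite end_trace_sym_pow_trig // chebU_sum //.
rewrite -[LHS]subr0 -[X in _ - X](mul0r (A 1 0)) -A01 -det_mx22.
rewrite AE !det_mulmx -[(P : 'M[C]_2)^-1]/(invmx P) det_inv det_SL2.
by rewrite mulr1 mulrV // -unitmxE.
Qed.

(** * The fields [Psi k] *)

Lemma Psi_comm (k : nat) (g : SL2 R) : GRing.comm (SL2val g) (Psi k g).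
Proof.
have cz (z : int) : GRing.comm (SL2val g) (SL2val g ^ z).
  by case: z => n; [|apply: commrV]; apply: commrX.
by apply: commrB.
Qed.

(** With t = tr g, Cayley-Hamilton gives g^2 = t g - 1, so tr(g^2 - 1) = (t^2 - 2) - 2. *)
Lemma trace_mul_Psi1 (g : SL2 R) :
  \tr (SL2val g * Psi 1 g) = \tr (SL2val g) ^+ 2 - 4%:R.
Proof.
have gV : SL2val g = (\tr (SL2val g))%:M - (SL2val g)^-1.
  by rewrite invr22 ?det_SL2 // opprB addrC subrK.
rewrite /= expr1z exprN1 mulrBr divrr ?SL2_unit // {2}gV mulrBr divrr ?SL2_unit //.
rewrite !raddfB /= mxtrace1 -[_ * _%:M]/(_ *m _%:M) mul_mx_scalar mxtraceZ.
ring.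
Qed.

End InvariantFunctions.

(* For m = 0 the right-hand side of the last formula is 0 by convention. *)
Theorem theorem4p6 (R : realType) (k : nat) (hk : (1 <= k)%N) (m : nat) (g : SL2 R) :
  [/\ vf_act (Psi k) (I_ m%:Z) g = m%:R * (I_ (m%:Z + k%:Z) g - I_ (m%:Z - k%:Z) g),
      vf_act (Psi 1) (chi_ m%:Z) g
        = m%:R * chi_ (m%:Z + 1) g - (m%:R + 2%:R) * chi_ (m%:Z - 1) g
    & vf_act (Psi 1) (J_ m) g
        = if m is m'.+1 then m%:R * (J_ m.+1 g - 4%:R * J_ m' g) else 0].
Proof.
split.
- rewrite (vf_act_trX (m := m)) //; last exact: Psi_comm.
  congr (_ * _); rewrite /= /Ifun !exprzDr ?SL2_unit //.
  by rewrite mulrBr raddfB.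
- rewrite (vf_act_horner _ (p := chebU _ m)) => [|h]; last exact: chifunE.
  rewrite trace_mul_Psi1.
  case: m => [|m].
    (* Here [chi_ (-1)] is 0 by definition, which removes the term with coefficient 2. *)
    by rewrite /= derivC horner0 mul0r mulr0n mul0r mulr0 subrr.
  have -> : m.+1%:Z + 1 = m.+2 by rewrite [RHS]intS addrC.
  have -> : m.+1%:Z - 1 = m by rewrite intS addrAC subrr add0r.
  rewrite !chifunE.
  by rewrite mulrC horner_chebU_deriv -natrD addn2.
- rewrite (vf_act_horner _ (p := 'X^m)) => [|h]; last by rewrite hornerXn.
  rewrite trace_mul_Psi1 derivXn.
  case: m => [|m]; first by rewrite mulr0n horner0 mul0r.
  rewrite /= /Jfun hornerMn hornerXn -mulr_natl.
  case: m => [|m]; rewrite !exprS; ring.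
Qed.
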